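(* Let $\mathcal{P}$ be a (finite) simplicial complex and $f:\mathcal{P}\to\mathbb{R}$ a Morse function. Then there is a global covering family $\mathcal{K}$ for the graded poset $\mathcal{P}^{op}$ such that moreover, for each $n\ge0$, $$b^{\mathcal{K}}_n=|\{\text{critical simplices of dimension } n\}|.$$
   Context: Morse functions. All simplicial complexes here have finitely many vertices; $\mathcal{P}$ is identified with the poset of its (non-empty) simplices ordered by inclusion, and $p^n$ denotes a simplex $p$ of dimension $n$. A function $f:\mathcal{P}\to\mathbb{R}$ is a Morse function if for each $p^n\in\mathcal{P}$, $|\{q^{n+1}>p\mid f(q)\le f(p)\}|\le1$ and $|\{q^{n-1}<p\mid f(p)\le f(q)\}|\le1$. A simplex $p^n$ is critical if $|\{q^{n+1}>p\mid f(q)\le f(p)\}|=0$ and $|\{q^{n-1}<p\mid f(p)\le f(q)\}|=0$. Graded posets. A poset is regarded as a category $\mathcal{Q}$ with exactly one arrow $p\to p'$ if $p\le p'$. The poset $\mathcal{Q}=\mathcal{P}^{op}$ is graded with $\deg$ = dimension of simplices. $\mathrm{Ob}_n(\mathcal{Q})$ is the set of objects of degree $n$ and $(p_0\downarrow\mathcal{Q})_n=\{p\mid p_0\le p\text{ in }\mathcal{Q},\ \deg p=n\}$. (For $\mathcal{Q}=\mathcal{P}^{op}$ there exists an adequate local covering family, so the notions below apply.) Numbers $R^{p_0}_n$, for $\deg(p_0)\ge n$: $R^{p_0}_0=1$ and $R^{p_0}_n=\sum_{p\in(p_0\downarrow\mathcal{Q})_{n-1}}R^p_{n-1}-R^{p_0}_{n-1}$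 for $n\ge1$. The functors $F_n:\mathcal{Q}\to\mathrm{Ab}$. $F_0=c_{\mathbb{Z}}$ is the constant functor with value $\mathbb{Z}$, and for $n\ge1$, $F_n(p_0)$ is the cokernel of the map $F_{n-1}(p_0)\to\prod_{p\in(p_0\downarrow\mathcal{Q})_{n-1}}F_{n-1}(p)$ with components $F_{n-1}(p_0\to p)$; arrows act by the maps induced by the projections between the products. Define $d_n:\prod_{p\in\mathrm{Ob}_n(\mathcal{Q})}F_n(p)\to\prod_{q\in\mathrm{Ob}_{n+1}(\mathcal{Q})}F_{n+1}(q)$ by letting $d_n(x)_q$ be the class of $(x_p)_{p\in(q\downarrow\mathcal{Q})_n}$ in $F_{n+1}(q)$. Global covering families. A homomorphism is pure if its cokernel is a free abelian group. A global covering family for $\mathcal{Q}$ is a family $\mathcal{K}=\{K_n\}_{n\ge0}$ with $K_n\subseteq\mathrm{Ob}_n(\mathcal{Q})$ such that (1) the restriction map $\varprojlim F_n\to\prod_{p\in K_n}F_n(p)$ is injective for each $n\ge0$; (2) for each $n\ge1$ the map $\prod_{p\in\mathrm{Ob}_{n-1}(\mathcal{Q})\setminus K_{n-1}}F_{n-1}(p)\to\prod_{p\in K_n}F_n(p)$, obtained from $d_{n-1}$ by precomposing with the inclusion (extension by zero) and postcomposing with the projection, is pure. The Betti numbers of $\mathcal{K}$ are $b^{\mathcal{K}}_0=\sum_{p\in K_0}R^p_0$ and $b^{\mathcal{K}}_n=\sum_{p\in K_{n-1}}R^p_{n-1}-\sum_{p\in\mathrm{Ob}_{n-1}(\mathcal{Q})}R^p_{n-1}+\sum_{p\in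 K_n}R^p_n$ for $n\ge1$. *)

(* Defs.v *)
From HB Require Import structures.
From mathcomp Require Import all_boot all_order all_algebra.
From mathcomp Require Import generic_quotient ring_quotient.
From mathcomp Require Import boolp reals.
From mathcomp Require Import freeg.

Set Implicit Arguments.
Unset Strict Implicit.
Unset Printing Implicit Defensive.

Import Order.TTheory GRing.Theory.
Local Open Scope ring_scope.

Section Product.
Variables (I : finType) (G : I -> zmodType).

Definition product := {dffun forall i, G i}.

HB.instance Definition _ := Choice.on product.

Implicit Types x y z : product.

Definition product_zero : product := finfun (fun i => 0).
Definition product_opp x : product := finfun (fun i => - x i).
Definition product_add x y : product := finfun (fun i => x i + y i).

Fact product_addA : associative product_add.
Proof. by move=> x y z; apply/ffunP=> i; rewrite !ffunE addrA. Qed.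
Fact product_addC : commutative product_add.
Proof. by move=> x y; apply/ffunP=> i; rewrite !ffunE addrC. Qed.
Fact product_add0 : left_id product_zero product_add.
Proof. by move=> x; apply/ffunP=> i; rewrite !ffunE add0r. Qed.
Fact product_addN : left_inverse product_zero product_opp product_add.
Proof. by move=> x; apply/ffunP=> i; rewrite !ffunE addNr. Qed.

HB.instance Definition _ := GRing.isZmodule.Build product
  product_addA product_addC product_add0 product_addN.

Lemma product0E i : (0 : product) i = 0. Proof. by rewrite ffunE. Qed.
Lemma productNE x i : (- x) i = - x i. Proof. by rewrite ffunE. Qed.
Lemma productDE x y i : (x + y) i = x i + y i. Proof. by rewrite ffunE. Qed.
Lemma productBE x y i : (x - y) i = x i - y i.
Proof. by rewrite productDE productNE. Qed.

End Product.

Section Cokernel.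
Variables (A B : zmodType) (f : {additive A -> B}).

Definition im_pred : {pred B} := fun y => `[< exists x, f x = y >].

Fact im_zmod_closed : zmod_closed im_pred.
Proof.
split=> [|_ _ /asboolP[x <-] /asboolP[y <-]]; apply/asboolP.
  by exists 0; rewrite raddf0.
by exists (x - y); rewrite raddfB.
Qed.

HB.instance Definition _ := GRing.isZmodClosed.Build B im_pred im_zmod_closed.

Definition coker : zmodType := Quotient.quot im_pred.

Definition coker_pi (y : B) : coker := \pi_(Quotient.quot im_pred)%qT y.

Fact coker_pi_is_zmod_morphism : zmod_morphism coker_pi.
Proof. by move=> x y; rewrite /coker_pi !piE. Qed.

HB.instance Definition _ :=
  GRing.isZmodMorphism.Build B coker coker_pi coker_pi_is_zmod_morphism.

Lemma coker_piP y : reflect (exists x, f x = y) (coker_pi y == 0).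
Proof.
apply: (iffP idP) => [|H].
  by rewrite /coker_pi -(raddf0 coker_pi) -Quotient.idealrBE subr0 => /asboolP.
rewrite /coker_pi -(raddf0 coker_pi) -Quotient.idealrBE subr0.
exact/asboolP.
Qed.

Lemma coker_pi_im x : coker_pi (f x) = 0.
Proof. by apply/eqP/coker_piP; exists x. Qed.

Lemma coker_ind (T : coker -> Prop) : (forall y, T (coker_pi y)) -> forall c, T c.
Proof. by move=> H c; rewrite -[c]reprK; apply: H. Qed.

Section Lift.
Variables (C : zmodType) (g : {additive B -> C}).
Hypothesis gf0 : forall x, g (f x) = 0.

Definition coker_lift (c : coker) : C := g (repr (c : Quotient.quot im_pred)).

Lemma coker_liftE y : coker_lift (coker_pi y) = g y.
Proof.
apply/eqP; rewrite -subr_eq0 -raddfB.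
have /coker_piP[x <-] : coker_pi (repr (coker_pi y : Quotient.quot im_pred) - y) == 0.
  by rewrite raddfB /= /coker_pi reprK subrr.
by rewrite gf0.
Qed.

Fact coker_lift_is_zmod_morphism : zmod_morphism coker_lift.
Proof.
elim/coker_ind=> x; elim/coker_ind=> y.
by rewrite -raddfB !coker_liftE raddfB.
Qed.

Definition coker_lift_additive : {additive coker -> C} :=
  HB.pack coker_lift
    (GRing.isZmodMorphism.Build coker C coker_lift coker_lift_is_zmod_morphism).

End Lift.
End Cokernel.

Definition free_abelian (A : zmodType) : Prop :=
  exists (I : choiceType) (h : {additive {freeg I / int} -> A}), bijective h.

Definition pure (A B : zmodType) (f : {additive A -> B}) : Prop :=
  free_abelian (coker f).

Section SubProduct.
Variables (Q : finType) (G : Q -> zmodType).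
Implicit Types S T : {set Q}.

Definition prod_over S : zmodType := product (fun p : {p : Q | p \in S} => G (val p)).

Definition tuple_over S (E : forall p, p \in S -> G p) : prod_over S :=
  finfun (fun p : {p | p \in S} => E (val p) (valP p)).

Definition component S (x : prod_over S) p (pS : p \in S) : G p := x (exist _ p pS).

Lemma component_tuple S E p (pS : p \in S) : component (tuple_over E) pS = E p pS.
Proof. by rewrite /component ffunE /=; congr E; apply: bool_irrelevance. Qed.

Lemma component_irr S (x : prod_over S) p (pS pS' : p \in S) : component x pS = component x pS'.
Proof. by congr component; apply: bool_irrelevance. Qed.

Lemma component_eq S (x y : prod_over S) :
  (forall p (pS : p \in S), component x pS = component y pS) -> x = y.
Proof. by move=> xy; apply/ffunP=> -[p pS]; apply: xy. Qed.

Lemma componentB S (x y : prod_over S) p (pS : p \in S) :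
  component (x - y) pS = component x pS - component y pS.
Proof.
exact: (@productBE _ (fun p : {p | p \in S} => G (val p)) x y (exist _ p pS)).
Qed.

Definition restr_fun S T (sST : S \subset T) (x : prod_over T) : prod_over S :=
  tuple_over (fun p pS => component x (subsetP sST p pS)).

Fact restr_is_zmod_morphism S T (sST : S \subset T) :
  zmod_morphism (restr_fun sST).
Proof. by move=> x y; apply: component_eq => p pS; rewrite !(componentB, component_tuple). Qed.

HB.instance Definition _ S T (sST : S \subset T) :=
  GRing.isZmodMorphism.Build _ _ (restr_fun sST) (restr_is_zmod_morphism sST).

Definition restr S T (sST : S \subset T) : {additive prod_over T -> prod_over S} :=
  restr_fun sST.

(* The inclusion S \subset T is not needed to define this map, but without it
   the componentinates outside T are lost. *)
Definition extend0_fun S T (x : prod_over S) : prod_over T :=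
  tuple_over (fun p _ =>
    match @idP (p \in S) with
    | ReflectT pS => component x pS
    | ReflectF _ => 0
    end).

Fact extend0_is_zmod_morphism S T : zmod_morphism (@extend0_fun S T).
Proof.
move=> x y; apply: component_eq => p pT; rewrite componentB !component_tuple.
by case: {-}_ / idP => [pS|_]; rewrite ?componentB ?subr0.
Qed.

HB.instance Definition _ S T :=
  GRing.isZmodMorphism.Build _ _ (@extend0_fun S T) (@extend0_is_zmod_morphism S T).

Definition extend0 S T : {additive prod_over S -> prod_over T} :=
  @extend0_fun S T.

End SubProduct.

Section Functors.
Variables (d : Order.disp_t) (Q : finPOrderType d).

Record functor := Functor {
  fobj :> Q -> zmodType;
  farr : forall p q : Q, (p <= q)%O -> {additive fobj p -> fobj q};
  farr_id : forall (p : Q) (pp : (p <= p)%O) x, farr pp x = x;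
  farr_comp : forall (p q r : Q)
    (pq : (p <= q)%O) (qr : (q <= r)%O) (pr : (p <= r)%O) x,
    farr qr (farr pq x) = farr pr x }.

Definition const_functor (A : zmodType) : functor :=
  @Functor (fun=> A) (fun p q _ => idfun) (fun _ _ _ => erefl)
    (fun _ _ _ _ _ _ _ => erefl).

Section Limit.
Variable F : functor.

Definition compatible (x : product F) : bool :=
  `[< forall (p q : Q) (pq : (p <= q)%O), farr F pq (x p) = x q >].

(* The projective limit in Ab, through its underlying set. *)
Definition lim := {x : product F | compatible x}.

Definition lim_restr (S : {set Q}) (x : lim) : prod_over F S :=
  tuple_over (fun p _ => val x p).

End Limit.

Variable deg : Q -> nat.

Definition Ob n : {set Q} := [set p | deg p == n].

Definition under_deg (p0 : Q) n : {set Q} := [set p | (p0 <= p)%O & deg p == n].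

Lemma under_le p0 n p : p \in under_deg p0 n -> (p0 <= p)%O.
Proof. by rewrite inE => /andP[]. Qed.

Lemma under_subset p0 p1 n : (p0 <= p1)%O -> under_deg p1 n \subset under_deg p0 n.
Proof.
move=> p01; apply/subsetP=> p; rewrite !inE => /andP[p1p ->].
by rewrite (le_trans p01 p1p).
Qed.

Lemma under_Ob p0 n : under_deg p0 n \subset Ob n.
Proof. by apply/subsetP=> p; rewrite !inE => /andP[]. Qed.

Section Next.
Variables (F : functor) (n : nat).

Definition under_map_fun (p0 : Q) (x : F p0) : prod_over F (under_deg p0 n) :=
  tuple_over (fun p pu => farr F (under_le pu) x).

Fact under_map_is_zmod_morphism p0 : zmod_morphism (@under_map_fun p0).
Proof. by move=> x y; apply: component_eq => q qu; rewrite !(componentB, component_tuple) raddfB. Qed.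

HB.instance Definition _ p0 := GRing.isZmodMorphism.Build _ _
  (@under_map_fun p0) (@under_map_is_zmod_morphism p0).

Definition under_map p0 : {additive F p0 -> prod_over F (under_deg p0 n)} :=
  @under_map_fun p0.

Definition next_obj p0 : zmodType := coker (under_map p0).

Definition next_class p0 : {additive prod_over F (under_deg p0 n) -> next_obj p0} :=
  @coker_pi _ _ (under_map p0).

Definition next_proj p q (pq : (p <= q)%O) :
    {additive prod_over F (under_deg p n) -> next_obj q} :=
  next_class q \o restr F (under_subset n pq).

Fact next_proj_im p q (pq : (p <= q)%O) x : next_proj pq (under_map p x) = 0.
Proof.
apply/eqP/coker_piP; exists (farr F pq x).
by apply: component_eq => r rq; rewrite !component_tuple; apply: farr_comp.
Qed.

Definition next_arr p q (pq : (p <= q)%O) : {additive next_obj p -> next_obj q} :=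
  coker_lift_additive (next_proj_im pq).

Lemma next_arrE p q (pq : (p <= q)%O) x :
  next_arr pq (next_class p x) = next_class q (restr F (under_subset n pq) x).
Proof. exact: (coker_liftE (next_proj_im pq)). Qed.

Fact next_arr_id p (pp : (p <= p)%O) x : next_arr pp x = x.
Proof.
elim/coker_ind: x => x; rewrite [LHS]next_arrE; congr coker_pi.
apply: component_eq => r rp; rewrite component_tuple.
exact: component_irr.
Qed.

Fact next_arr_comp p q r
    (pq : (p <= q)%O) (qr : (q <= r)%O) (pr : (p <= r)%O) x :
  next_arr qr (next_arr pq x) = next_arr pr x.
Proof.
elim/coker_ind: x => x; rewrite [next_arr pq _]next_arrE !next_arrE.
congr coker_pi.
apply: component_eq => s sr; rewrite !component_tuple.
exact: component_irr.
Qed.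

Definition next_functor : functor :=
  @Functor next_obj next_arr next_arr_id next_arr_comp.

End Next.

(* No restriction n <= deg p0 is imposed. If every arrow p0 -> p with p0 <> p
   strictly decreases deg, then Fn n p0 is the zero group for deg p0 < n. *)
Fixpoint Fn (n : nat) : functor :=
  if n is m.+1 then next_functor (Fn m) m else const_functor int.

Definition dn_fun n (x : prod_over (Fn n) (Ob n)) :
    prod_over (Fn n.+1) (Ob n.+1) :=
  tuple_over (fun q _ =>
    next_class (Fn n) n q (restr (Fn n) (under_Ob q n) x)).

Fact dn_is_zmod_morphism n : zmod_morphism (@dn_fun n).
Proof. by move=> x y; apply: component_eq => q qn; rewrite !(componentB, component_tuple) !raddfB. Qed.

HB.instance Definition _ n :=
  GRing.isZmodMorphism.Build _ _ (@dn_fun n) (@dn_is_zmod_morphism n).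

Definition dn n :
    {additive prod_over (Fn n) (Ob n) -> prod_over (Fn n.+1) (Ob n.+1)} :=
  @dn_fun n.

Definition cover_map n (S T : {set Q}) (sT : T \subset Ob n.+1) :
    {additive prod_over (Fn n) (Ob n :\: S) -> prod_over (Fn n.+1) T} :=
  restr (Fn n.+1) sT \o dn n \o extend0 (Fn n) (Ob n :\: S) (Ob n).

Record global_covering_family := GlobalCoveringFamily {
  gcf_set :> nat -> {set Q};
  gcf_sub : forall n, gcf_set n \subset Ob n;
  gcf_inj : forall n, injective (@lim_restr (Fn n) (gcf_set n));
  gcf_pure : forall n, pure (cover_map (gcf_set n) (gcf_sub n.+1)) }.

(* Integer-valued, since truncated subtraction on nat would be wrong. Only the
   values with n <= deg p0 are meaningful. *)
Fixpoint Rn (n : nat) (p0 : Q) : int :=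
  if n is m.+1 then \sum_(p in under_deg p0 m) Rn m p - Rn m p0 else 1.

Definition betti (K : global_covering_family) (n : nat) : int :=
  if n is m.+1 then
    \sum_(p in K m) Rn m p - \sum_(p in Ob m) Rn m p + \sum_(p in K m.+1) Rn m.+1 p
  else \sum_(p in K 0%N) Rn 0 p.

End Functors.

Record simplicial_complex (V : finType) := SimplicialComplex {
  faces :> {set {set V}};
  faces_nonempty : set0 \notin faces;
  faces_closed : forall s t : {set V},
    s \in faces -> t \subset s -> t != set0 -> t \in faces }.

Definition simplex (V : finType) (P : simplicial_complex V) : Type :=
  {s : {set V} | s \in faces P}.

Section Simplices.
Variables (V : finType) (P : simplicial_complex V).
Local Notation simplex := (simplex P).

HB.instance Definition _ := SubFinite.on simplex.

Fact simplex_display : Order.disp_t. Proof. exact: Order.Disp tt tt. Qed.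

Definition simplex_le (s t : simplex) : bool := val s \subset val t.

Fact simplex_le_refl : reflexive simplex_le.
Proof. by move=> s; apply: subxx. Qed.
Fact simplex_le_anti : antisymmetric simplex_le.
Proof. by move=> s t st; apply/val_inj/eqP; rewrite eqEsubset. Qed.
Fact simplex_le_trans : transitive simplex_le.
Proof. by move=> s t u; apply: subset_trans. Qed.

HB.instance Definition _ := Order.Le_isPOrder.Build simplex_display simplex
  simplex_le_refl simplex_le_anti simplex_le_trans.

Definition simplex_dim (s : simplex) : nat := #|val s|.-1.

(* The category P^op: there is an arrow p -> q when q is a face of p. *)
Definition simplex_op : finPOrderType _ := (simplex^d)%type.
Definition simplex_op_deg : simplex_op -> nat := simplex_dim.

Section Morse.
Variables (R : realType) (f : simplex -> R).

Definition up_exceptions (p : simplex) : {set simplex} :=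
  [set q | [&& (p < q)%O, simplex_dim q == (simplex_dim p).+1 & f q <= f p]].

Definition down_exceptions (p : simplex) : {set simplex} :=
  [set q | [&& (q < p)%O, simplex_dim p == (simplex_dim q).+1 & f p <= f q]].

Definition morse : Prop :=
  forall p, (#|up_exceptions p| <= 1)%N /\ (#|down_exceptions p| <= 1)%N.

Definition critical (p : simplex) : bool :=
  (#|up_exceptions p| == 0)%N && (#|down_exceptions p| == 0)%N.

End Morse.
End Simplices.

(* Main.v *)
From HB Require Import structures.
Require Import Defs.
From mathcomp Require Import all_boot all_order all_algebra.
From mathcomp Require Import boolp reals.
From mathcomp Require Import freeg.

(* Fix a vertex v of a simplex q. By induction on n, F_n(q) is the product of
   the F_n(p) over the n-dimensional faces p of q containing v: classes in
   F_{n+1}(q) have unique representatives supported on the faces p avoiding v,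
   and p |-> p + v matches these with the (n+1)-dimensional faces containing v.
   Hence F_n(q) embeds in the product over all n-dimensional faces, F_n(p) is
   infinite cyclic when dim p = n, and F_n(p) -> F_{n+1}(q) is an isomorphism
   when p is a facet of q with dim q = n+1; no orientation signs are needed.

   K_n consists of the n-simplices without upper exception. The others (tails)
   are paired by f with simplices of dimension n+1 (heads), which lie in K_{n+1}
   by Forman's lemma. A facet of the head of t other than t has a smaller value
   of f than t, so d_n from tails to heads is triangular with isomorphisms on
   the diagonal. This makes a compatible family vanishing on K_n zero, and
   identifies the cokernel in the purity condition with the free group on the
   critical (n+1)-simplices. *)

Set Implicit Arguments.
Unset Strict Implicit.
Unset Printing Implicit Defensive.

Import Order.TTheory GRing.Theory Num.Theory.
Local Open Scope ring_scope.

(** * Products over subsets of the poset: coordinates and tuples supported at one index *)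

Section Components.
Variables (Q : finType) (G : Q -> zmodType).
Implicit Types S T : {set Q}.

Definition coordinate S p (pS : p \in S) (x : prod_over G S) : G p := component x pS.

Fact coordinate_is_zmod_morphism S p (pS : p \in S) : zmod_morphism (coordinate pS).
Proof. by move=> x y; apply: componentB. Qed.

HB.instance Definition _ S p (pS : p \in S) :=
  GRing.isZmodMorphism.Build _ _ (coordinate pS) (coordinate_is_zmod_morphism pS).

Lemma component0 S p (pS : p \in S) : component (0 : prod_over G S) pS = 0.
Proof. exact: (raddf0 (coordinate pS)). Qed.

Lemma componentD S (x y : prod_over G S) p (pS : p \in S) :
  component (x + y) pS = component x pS + component y pS.
Proof. exact: (raddfD (coordinate pS)). Qed.

Lemma componentMz S (x : prod_over G S) p (pS : p \in S) (k : int) :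
  component (x *~ k) pS = component x pS *~ k.
Proof. exact: (raddfMz (coordinate pS)). Qed.

Lemma component_sum S (I : finType) (x : I -> prod_over G S) p (pS : p \in S) :
  component (\sum_i x i) pS = \sum_i component (x i) pS.
Proof. exact: (raddf_sum (coordinate pS)). Qed.

Lemma component_restr S T (sST : S \subset T) (x : prod_over G T) p (pS : p \in S)
    (pT : p \in T) :
  component (restr G sST x) pS = component x pT.
Proof. by rewrite component_tuple; apply: component_irr. Qed.

Lemma component_extend0 S T (x : prod_over G S) p (pS : p \in S) (pT : p \in T) :
  component (extend0 G S T x) pT = component x pS.
Proof.
rewrite component_tuple; case: {-}_ / idP => [pS'|/(_ pS)//].
exact: component_irr.
Qed.

Lemma component_extend0_out S T (x : prod_over G S) p (pT : p \in T) :
  p \notin S -> component (extend0 G S T x) pT = 0.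
Proof.
by move=> pS; rewrite component_tuple; case: {-}_ / idP => // pS'; rewrite pS' in pS.
Qed.

Lemma tuple_choice S (R : forall p, p \in S -> G p -> Prop) :
  (forall p (pS : p \in S), exists x, R p pS x) ->
  exists y : prod_over G S, forall p (pS : p \in S), R p pS (component y pS).
Proof.
move=> H; exists (tuple_over (fun p pS => sval (cid (H p pS)))) => p pS.
by rewrite component_tuple; apply: svalP.
Qed.

Definition supported_at S p (y : prod_over G S) : Prop :=
  forall p' (p'S : p' \in S), p' != p -> component y p'S = 0.

Lemma single_exists S p (pS : p \in S) (u : G p) :
  exists2 y : prod_over G S, supported_at p y & component y pS = u.
Proof.
(* The group varies with the index, so [u] is transported along the proof of [p = p']; at [p] itself
   [eq_axiomK] removes the transport. *)
exists (tuple_over (fun p' _ =>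
  match p =P p' with ReflectT e => eq_rect p G u p' e | ReflectF _ => 0 end)).
  by move=> p' p'S; rewrite component_tuple; case: eqP => // pp /eqP[].
by rewrite component_tuple; case: eqP => // e; rewrite (eq_axiomK e).
Qed.

Lemma supported_at_eq S p (pS : p \in S) (y z : prod_over G S) :
  supported_at p y -> supported_at p z -> component y pS = component z pS -> y = z.
Proof.
move=> sy sz eyz; apply: component_eq => p' p'S.
have [e|ne] := eqVneq p' p; last by rewrite sy ?sz.
by subst p'; rewrite (bool_irrelevance p'S pS).
Qed.

Lemma supported_atMz S p (y : prod_over G S) (k : int) :
  supported_at p y -> supported_at p (y *~ k).
Proof. by move=> sy r rS rp; rewrite componentMz sy ?mul0rz. Qed.

Section SupportedSum.
Variables (S : {set Q}) (I : finType) (h : I -> Q) (x : I -> prod_over G S).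
Hypothesis sx : forall i, supported_at (h i) (x i).

Lemma component_sum_out p (pS : p \in S) :
  (forall i, p != h i) -> component (\sum_i x i) pS = 0.
Proof. by move=> ph; rewrite component_sum big1 // => i _; apply: sx. Qed.

Lemma component_sum_at i (iS : h i \in S) :
  injective h -> component (\sum_j x j) iS = component (x i) iS.
Proof.
move=> h_inj; rewrite component_sum (bigD1 i) //= big1 ?addr0 // => j ji.
by apply: sx; rewrite (inj_eq h_inj) eq_sym.
Qed.

End SupportedSum.

End Components.

(** * Classes in the cokernels defining the next functor *)

Section Classes.
Variables (d : Order.disp_t) (Q : finPOrderType d) (deg : Q -> nat).
Variables (F : functor Q) (n : nat).

Lemma next_class_eq0 q (y : prod_over F (under_deg deg q n)) :
  next_class deg F n q y = 0 <-> exists x, under_map deg F n q x = y.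
Proof.
split=> [/eqP/coker_piP//|[x <-]].
exact: (coker_pi_im (under_map deg F n q)).
Qed.

Lemma next_class_surj q (c : next_obj deg F n q) :
  exists y, next_class deg F n q y = c.
Proof. by elim/coker_ind: c => y; exists y. Qed.

Lemma component_under_map q x p (pu : p \in under_deg deg q n) (qp : (q <= p)%O) :
  component (under_map deg F n q x) pu = farr F qp x.
Proof.
by rewrite component_tuple; congr (farr F _ x); apply: bool_irrelevance.
Qed.

End Classes.

(** * Faces of a simplex and the structure of the groups $F_n(q)$ *)

Section SimplexOp.
Variables (V : finType) (P : simplicial_complex V).
Local Notation Q := (simplex_op P).
Local Notation deg := (@simplex_op_deg V P).
Implicit Types p q r : Q.

Definition vertices p : {set V} := val (p : simplex P).

Lemma le_vertices p q : (p <= q)%O = (vertices q \subset vertices p).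
Proof. by []. Qed.

Lemma vertices_inj : injective vertices.
Proof. exact: val_inj. Qed.

Lemma card_vertices p : #|vertices p| = (deg p).+1.
Proof.
rewrite /simplex_op_deg /simplex_dim prednK // card_gt0.
by apply: contraTneq (valP (p : simplex P)) => ->; apply: faces_nonempty.
Qed.

Lemma vertex_exists p : exists v, v \in vertices p.
Proof. by apply/set0Pn; rewrite -card_gt0 card_vertices. Qed.

Lemma face_exists q (s : {set V}) :
  s \subset vertices q -> (0 < #|s|)%N -> exists p, vertices p = s.
Proof.
rewrite card_gt0 => sq s0.
by exists (exist _ s (faces_closed (valP (q : simplex P)) sq s0)).
Qed.

Lemma mem_under p q n :
  (p \in under_deg deg q n) = (vertices p \subset vertices q) && (#|vertices p| == n.+1).
Proof. by rewrite inE le_vertices card_vertices eqSS. Qed.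

Lemma subset_under p q n : p \in under_deg deg q n -> vertices p \subset vertices q.
Proof. by rewrite mem_under => /andP[]. Qed.

Lemma card_under p q n : p \in under_deg deg q n -> #|vertices p| = n.+1.
Proof. by rewrite mem_under => /andP[_ /eqP]. Qed.

(* Normal form for representatives: a class of F_{n+1}(q) has exactly one
   representative vanishing on the n-dimensional faces that contain v. *)
Definition vanishes_at n q (v : V) (y : prod_over (Fn deg n) (under_deg deg q n)) :=
  forall p (pu : p \in under_deg deg q n), v \in vertices p -> component y pu = 0.

(* F_n(q) is identified with the product of the F_n(p) over the n-dimensional
   faces p of q containing v. *)
Definition star_injective n := forall q v (x : Fn deg n q),
  v \in vertices q -> vanishes_at v (under_map deg (Fn deg n) n q x) -> x = 0.

Definition star_surjective n :=
  forall q v (y : prod_over (Fn deg n) (under_deg deg q n)),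
  v \in vertices q ->
  exists x, vanishes_at v (under_map deg (Fn deg n) n q x - y).

(** Existence of the normal form: from any representative, subtract the image of an [x] that agrees
    with it on the faces containing [v]. *)
Lemma vanishing_representative n q v (c : Fn deg n.+1 q) :
  star_surjective n -> v \in vertices q ->
  exists2 y, vanishes_at v y & next_class deg (Fn deg n) n q y = c.
Proof.
move=> surj vq; have [y <-] := next_class_surj c.
have [x xy] := surj q v y vq.
exists (y - under_map deg (Fn deg n) n q x).
  by move=> p pu vp; rewrite -opprB -mulrN1z componentMz xy ?mul0rz.
by rewrite raddfB [X in _ - X](coker_pi_im (under_map deg (Fn deg n) n q)) subr0.
Qed.

(** Uniqueness of the normal form: a representative of zero is the image of some [x], and
    [star_injective] forces [x = 0]. *)
Lemma vanishing_class0 n q v (y : prod_over (Fn deg n) (under_deg deg q n)) :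
  star_injective n -> v \in vertices q -> vanishes_at v y ->
  next_class deg (Fn deg n) n q y = 0 -> y = 0.
Proof.
move=> inj vq yv y0; have [x xy] := (next_class_eq0 y).1 y0.
by rewrite -xy in yv *; rewrite (inj q v x vq yv) raddf0.
Qed.

(** Take the normal form [y] of the class. A face [p] avoiding [v] is a facet of [q' = p + v]; the
    restriction of [y] to [q'] is again in normal form and has class zero, so it vanishes, in
    particular at [p]. *)
Lemma star_injective_step n : star_injective n -> star_surjective n ->
  star_injective n.+1.
Proof.
move=> inj surj q v c vq; have [y yv <-] := vanishing_representative c surj vq.
move=> yres; suff -> : y = 0 by rewrite raddf0.
apply: component_eq => p pu; rewrite component0.
have [vp|vp] := boolP (v \in vertices p); first exact: yv.
have [||q' q'E] := @face_exists q (v |: vertices p).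
- by rewrite subUset sub1set vq (subset_under pu).
- by rewrite cardsU1 vp.
have q'u : q' \in under_deg deg q n.+1.
  by rewrite mem_under q'E subUset sub1set vq (subset_under pu) cardsU1 vp (card_under pu) /= add1n.
have vq' : v \in vertices q' by rewrite q'E setU11.
have pu' : p \in under_deg deg q' n.
  by rewrite mem_under q'E subsetUr (card_under pu) eqxx.
have := yres q' q'u vq'; rewrite (component_under_map _ _ (under_le q'u)).
rewrite [farr _ _ _]next_arrE => res0.
have resv : vanishes_at v (restr (Fn deg n) (under_subset deg n (under_le q'u)) y).
  by move=> r ru vr; rewrite component_tuple; apply: yv.
have /(congr1 (fun w => component w pu')) := vanishing_class0 inj vq' resv res0.
by rewrite component0 (component_restr _ _ _ pu).
Qed.

(** Normal forms [w] of the entries of [z] glue without any compatibility condition: an [n]-face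
    avoiding [v] lies in exactly one [(n+1)]-face containing [v], and on faces containing [v] all
    the normal forms are zero. *)
Lemma star_surjective_step n : star_surjective n -> star_surjective n.+1.
Proof.
move=> surj q v z vq.
(* Nothing is asked when [q'] avoids [v], so that the choice can run over all [(n+1)]-faces. *)
pose R q' (q'u : q' \in under_deg deg q n.+1)
    (w : prod_over (Fn deg n) (under_deg deg q' n)) :=
  v \in vertices q' -> vanishes_at v w /\ next_class deg (Fn deg n) n q' w = component z q'u.
have : forall q' q'u, exists w, @R q' q'u w.
  move=> q' q'u; have [vq'|vq'] := boolP (v \in vertices q'); last first.
    by exists 0 => vq1; rewrite vq1 in vq'.
  by have [w ? ?] := vanishing_representative (component z q'u) surj vq'; exists w.
move/(@tuple_choice _ (fun q' => prod_over (Fn deg n) (under_deg deg q' n))) => [w wP].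
have [y yP] : exists y : prod_over (Fn deg n) (under_deg deg q n),
    forall p (pu : p \in under_deg deg q n) q' (q'u : q' \in under_deg deg q n.+1)
      (pu' : p \in under_deg deg q' n), v \in vertices q' ->
      component y pu = component (component w q'u) pu'.
  apply: (@tuple_choice _ _ _ (fun p pu x => forall q' (q'u : q' \in under_deg deg q n.+1)
      (pu' : p \in under_deg deg q' n), v \in vertices q' ->
      x = component (component w q'u) pu')) => p pu.
  have [vp|vp] := boolP (v \in vertices p).
    exists 0 => q' q'u pu' vq'; have [wv _] := wP q' q'u vq'.
    by rewrite wv.
  have [||q' q'E] := @face_exists q (v |: vertices p).
  - by rewrite subUset sub1set vq (subset_under pu).
  - by rewrite cardsU1 vp.
  have q'u : q' \in under_deg deg q n.+1.
    by rewrite mem_under q'E subUset sub1set vq (subset_under pu) cardsU1 vp (card_under pu) /= add1n.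
  have pu' : p \in under_deg deg q' n.
    by rewrite mem_under q'E subsetUr (card_under pu) eqxx.
  exists (component (component w q'u) pu') => r ru pr vr.
  have e : r = q'.
    apply/vertices_inj/esym/eqP; rewrite eqEcard q'E subUset sub1set vr (subset_under pr).
    by rewrite cardsU1 vp (card_under pr) (card_under ru) /= add1n.
  by subst r; rewrite (bool_irrelevance ru q'u) (bool_irrelevance pr pu').
exists (next_class deg (Fn deg n) n q y) => q' q'u vq'.
rewrite componentB (component_under_map _ _ (under_le q'u)).
rewrite [farr _ _ _]next_arrE -(wP q' q'u vq').2.
apply/eqP; rewrite subr_eq0; apply/eqP; congr (next_class _ _ _ _ _).
apply: component_eq => p pu'.
have pu : p \in under_deg deg q n.
  by rewrite mem_under (subset_trans (subset_under pu') (subset_under q'u)) (card_under pu') eqxx.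
by rewrite (component_restr _ _ _ pu); apply: yP.
Qed.

Lemma star_bijective n : star_injective n /\ star_surjective n.
Proof.
elim: n => [|n [inj surj]]; last first.
  split; [exact: star_injective_step | exact: star_surjective_step].
(* For [n = 0] the only face involved is the vertex [[set v]], and the constant functor acts by the
   identity. *)
split=> q v x vq.
  have [||p pE] := @face_exists q [set v]; rewrite ?sub1set ?cards1 //.
  have pu : p \in under_deg deg q 0 by rewrite mem_under pE sub1set vq cards1.
  by move/(_ p pu); rewrite pE set11 component_tuple; apply.
have [||p pE] := @face_exists q [set v]; rewrite ?sub1set ?cards1 //.
have pu : p \in under_deg deg q 0 by rewrite mem_under pE sub1set vq cards1.
exists (component x pu) => r ru vr; rewrite componentB.
have e : r = p.
  apply/vertices_inj/esym/eqP; rewrite eqEcard pE sub1set vr cards1.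
  by rewrite (card_under ru).
by subst r; rewrite component_tuple (bool_irrelevance ru pu) subrr.
Qed.


(** This allows a compatible family to be tested on simplices of dimension [n] only. *)
Lemma under_map_eq0 n q (x : Fn deg n q) :
  under_map deg (Fn deg n) n q x = 0 -> x = 0.
Proof.
have [v vq] := vertex_exists q => x0; apply: ((star_bijective n).1 q v x vq).
by move=> p pu _; rewrite x0 component0.
Qed.

Lemma card_facet n q v : deg q = n.+1 -> v \in vertices q -> #|vertices q :\ v| = n.+1.
Proof.
by move=> qn vq; have := card_vertices q; rewrite (cardsD1 v) vq qn => -[].
Qed.

Lemma facet_opposite n q p : deg q = n.+1 -> p \in under_deg deg q n ->
  exists2 v, v \in vertices q & vertices p = vertices q :\ v.
Proof.
move=> qn pu; have pq := subset_under pu.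
have /subsetPn[v vq vp] : ~~ (vertices q \subset vertices p).
  by apply/negP => /subset_leq_card; rewrite card_vertices qn (card_under pu) ltnn.
exists v => //; apply/eqP; rewrite eqEcard subsetD1 pq vp /=.
by rewrite (card_facet qn vq) (card_under pu).
Qed.

(** The facet [p] avoids its opposite vertex [v], so a tuple supported at [p] is in normal form for
    [v]. *)
Lemma single_class_eq0 n q p (pu : p \in under_deg deg q n)
    (y : prod_over (Fn deg n) (under_deg deg q n)) :
  deg q = n.+1 -> supported_at p y -> next_class deg (Fn deg n) n q y = 0 ->
  component y pu = 0.
Proof.
move=> qn sy y0; have [v vq pE] := facet_opposite qn pu.
rewrite (vanishing_class0 (star_bijective n).1 vq _ y0) ?component0 //.
move=> r ru vr; apply: sy; apply: contraTneq vr => ->.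
by rewrite pE !inE eqxx.
Qed.

(** Conversely, [p] is the only [n]-face avoiding its opposite vertex [v], so a normal form for [v]
    is supported at [p]. *)
Lemma single_class_surj n q p (c : Fn deg n.+1 q) :
  deg q = n.+1 -> p \in under_deg deg q n ->
  exists2 y, supported_at p y & next_class deg (Fn deg n) n q y = c.
Proof.
move=> qn pu; have [v vq pE] := facet_opposite qn pu.
have [y yv yc] := vanishing_representative c (star_bijective n).2 vq.
exists y => // r ru rp; apply: yv; apply: contraNT rp => vr.
apply/eqP/vertices_inj/eqP; rewrite eqEcard (card_under pu) (card_under ru) leqnn.
by rewrite pE subsetD1 (subset_under ru) vr.
Qed.

(** Starting from $F_0 = \mathbb{Z}$, a generator at a facet is carried to [q] by the isomorphism
    $F_n(p) \to F_{n+1}(q)$. *)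
Lemma generator_exists n p : deg p = n -> exists u : Fn deg n p,
  (forall x, exists k : int, x = u *~ k) /\ (forall k : int, u *~ k = 0 -> k = 0).
Proof.
elim: n p => [|n IHn] q qn.
  by exists (1 : int); split=> [x|k]; [exists x; rewrite intz | rewrite intz].
have [v vq] := vertex_exists q.
have pc := card_facet qn vq.
have [||p pE] := @face_exists q (vertices q :\ v); rewrite ?subD1set ?pc //.
have pu : p \in under_deg deg q n by rewrite mem_under pE subD1set pc eqxx.
have [|u [ugen ufree]] := IHn p.
  by apply/eqP; rewrite -eqSS -card_vertices pE pc.
have [y sy yu] := single_exists pu u.
have syk k := supported_atMz k sy.
exists (next_class deg (Fn deg n) n q y); split=> [c|k].
  have [z sz <-] := single_class_surj c qn pu.
  have [k zk] := ugen (component z pu); exists k.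
  rewrite -raddfMz; congr (next_class _ _ _ _ _).
  by apply: (supported_at_eq (pS := pu)) => //; rewrite componentMz yu.
rewrite -raddfMz => yk0; apply: ufree; rewrite -yu -componentMz.
exact: single_class_eq0 yk0.
Qed.

(** * The numbers $R$ as binomial coefficients *)

Lemma card_under_deg p n : #|under_deg deg p n| = 'C((deg p).+1, n.+1).
Proof.
rewrite -(card_vertices p) -(card_imset (under_deg deg p n) vertices_inj) -cards_draws.
apply/eq_card => s; rewrite inE; apply/imsetP/andP => [[q qu ->]|[sp sn]].
  by move: qu; rewrite mem_under => /andP[].
have [||q qE] := @face_exists p s => //; first by rewrite (eqP sn).
by exists q; rewrite ?mem_under qE // sp.
Qed.

(** The terms of the defining sum are all 1, so the sum counts [n]-faces and the recursion becomes
    Pascal's rule. *)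
Lemma RnE n p : (n <= deg p)%N -> Rn deg n p = 'C(deg p, n)%:Z.
Proof.
elim: n p => [|n IHn] p np /=; first by rewrite bin0.
rewrite (eq_bigr (fun=> 1)); last first.
  by move=> q; rewrite inE => /andP[_ /eqP qn]; rewrite IHn qn ?binn.
rewrite IHn ?(ltnW np)// sumr_const card_under_deg.
by rewrite natz binS PoszD addrK.
Qed.

End SimplexOp.

(** * A basis criterion for free abelian groups *)

Lemma free_abelian_basis (A : zmodType) (I : finType) (e : I -> A) :
  (forall x, exists k : I -> int, x = \sum_i e i *~ k i) ->
  (forall k : I -> int, \sum_i e i *~ k i = 0 -> forall i, k i = 0) ->
  free_abelian A.
Proof.
move=> gen indep; pose h (D : {freeg I / int}) := \sum_i e i *~ coeff i D.
have h_add : zmod_morphism h.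
  move=> D E; rewrite -sumrB; apply: eq_bigr => i _.
  by rewrite raddfB mulrzBr.
pose hA : {additive {freeg I / int} -> A} :=
  HB.pack h (GRing.isZmodMorphism.Build _ _ h h_add).
exists I, hA => /=.
have hK x : exists D, h D = x.
  have [k ->] := gen x; exists (\sum_i << k i *g i >>).
  apply: eq_bigr => i _; rewrite raddf_sum (bigD1 i) //= coeffU eqxx mulr1.
  by rewrite big1 ?addr0 // => j /negPf ji; rewrite coeffU ji mulr0.
(* Spanning yields a right inverse of [h] by choice; independence of the coefficients makes it
   two-sided. *)
have [g gK] := choice hK; exists g => // D.
apply/eqP; rewrite -subr_eq0; apply/freeg_eqP => i; rewrite coeff0.
apply: (indep (fun i => coeff i (g (h D) - D))).
by rewrite -/(h _) h_add gK subrr.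
Qed.

(** * The pairing of simplices by the Morse function *)

Section MorseCovering.
Variables (R : realType) (V : finType) (P : simplicial_complex V).
Variables (f : simplex P -> R) (f_morse : morse f).
Local Notation Q := (simplex_op P).
Local Notation deg := (@simplex_op_deg V P).
Local Notation up := (up_exceptions f).
Local Notation down := (down_exceptions f).

Lemma mem_down (p q : simplex P) : (p \in down q) = (q \in up p).
Proof. by rewrite !inE. Qed.

(** Passage to the reversed order of [Q]; strict inclusion follows from the difference of
    dimensions. *)
Lemma mem_up (p q : Q) n : deg p = n ->
  (q \in up p) = [&& p \in under_deg deg q n, deg q == n.+1 & f q <= f p].
Proof.
move=> pn; rewrite !inE [in RHS]le_vertices pn eqxx andbT lt_neqAle -[simplex_dim p]/(deg p) pn.
rewrite -[simplex_dim q]/(deg q).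
case: (deg q =P n.+1) => [qn|]; rewrite ?andbF //=.
case: eqP => //= pq; rewrite -pq pn in qn.
by case: (n_Sn n qn).
Qed.

Lemma up_unique (p q r : simplex P) : q \in up p -> r \in up p -> q = r.
Proof. by move=> qp rp; apply: (card_le1_eqP (f_morse p).1). Qed.

Lemma down_unique (p q r : simplex P) : p \in up q -> p \in up r -> q = r.
Proof.
by rewrite -!mem_down => qp rp; apply: (card_le1_eqP (f_morse p).2).
Qed.

(** If [f s <= f p], then [p] would be a second lower exception of [s] besides [t]. Hence
    [f p < f s <= f t]. *)
Lemma facet_lt (t s p : Q) n : deg t = n -> s \in up t ->
  p \in under_deg deg s n -> p != t -> f p < f t.
Proof.
move=> tn st ps pt; have := st; rewrite (mem_up _ tn) => /and3P[_ sn fst].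
apply: lt_le_trans fst; rewrite real_ltNge ?num_real //.
apply: contraNN pt => fsp; apply/eqP.
apply: (down_unique (p := s)) => //.
rewrite (@mem_up _ _ n) ?ps ?sn //.
by apply/eqP; rewrite -eqSS -card_vertices (card_under ps).
Qed.

(* Forman's lemma. For r < p < q with f q <= f p <= f r, the other simplex p'
   between r and q satisfies f p' < f p <= f r, a second exception above r. *)
Lemma up_down_disjoint (r p q : Q) : p \in up r -> q \in up p -> False.
Proof.
move=> pr qp; pose n := deg r.
have := pr; rewrite (@mem_up _ _ n) // => /and3P[rp /eqP pn fpr].
have := qp; rewrite (@mem_up _ _ n.+1) // => /and3P[pq /eqP qn fqp].
have [w wq pE] := facet_opposite qn pq.
have wr : w \notin vertices r.
  by apply/negP => /(subsetP (subset_under rp)); rewrite pE !inE eqxx.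
have [||p' p'E] := @face_exists _ _ q (w |: vertices r).
- by rewrite subUset sub1set wq (subset_trans (subset_under rp) (subset_under pq)).
- by rewrite cardsU1 wr.
have p'q : p' \in under_deg deg q n.+1.
  rewrite mem_under p'E subUset sub1set wq cardsU1 wr (card_under rp) /= add1n eqxx andbT.
  exact: subset_trans (subset_under rp) (subset_under pq).
have p'p : p' != p.
  by apply/eqP => /(congr1 (@vertices V P))/setP/(_ w); rewrite p'E pE !inE eqxx.
have fp' := facet_lt pn qp p'q p'p.
case/eqP: p'p; apply: (up_unique (p := r)) => //.
rewrite (@mem_up _ _ n) // (le_trans (ltW fp') fpr) andbT.
rewrite -eqSS -card_vertices (card_under p'q) eqxx andbT.
by rewrite mem_under p'E subsetUr (card_under rp) eqxx.
Qed.

(** * The covering sets and injectivity on the limit *)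

Definition covering n : {set Q} := [set p : Q | (deg p == n) && (up p == set0)].

Lemma covering_sub n : covering n \subset Ob deg n.
Proof. by apply/subsetP => p; rewrite !inE => /andP[]. Qed.

Lemma deg_covering n (p : Q) : p \in covering n -> deg p = n.
Proof. by rewrite inE => /andP[/eqP]. Qed.

Lemma in_tails n (t : Q) : (t \in Ob deg n :\: covering n) = (deg t == n) && (up t != set0).
Proof. by rewrite !inE; case: eqP; rewrite ?andbF ?andbT. Qed.

Lemma tailP n (t : Q) : t \in Ob deg n :\: covering n ->
  exists s : Q, [/\ s \in covering n.+1, t \in under_deg deg s n & s \in up t].
Proof.
rewrite in_tails => /andP[/eqP tn /set0Pn[s st]]; exists (s : Q).
have /and3P[ts sn _] : [&& t \in under_deg deg s n, deg s == n.+1 & f s <= f t].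
  by rewrite -mem_up.
split=> //.
rewrite inE sn; apply/negPn/negP => /set0Pn[q qs].
exact: up_down_disjoint st qs.
Qed.

(** Replaces real values of [f] by natural numbers, so that triangularity can be exploited by
    induction; simplices with equal values share a rank. *)
Definition value_rank (t : Q) := #|[set u : simplex P | f u < f t]|.

Lemma value_rank_lt (p t : Q) : f p < f t -> (value_rank p < value_rank t)%N.
Proof.
move=> pt; apply/proper_card/properP; split.
  by apply/subsetP => u; rewrite !inE => /lt_trans; apply.
by exists (p : simplex P); rewrite inE ?pt // ltxx.
Qed.

Lemma lim_restr_injective n : injective (@lim_restr _ _ (Fn deg n) (covering n)).
Proof.
move=> x y xy; pose z p : Fn deg n p := val x p - val y p.
have zarr p q (pq : (p <= q)%O) : farr (Fn deg n) pq (z p) = z q.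
  rewrite raddfB; congr (_ - _).
    by have /asboolP := valP x; apply.
  by have /asboolP := valP y; apply.
have zK p : p \in covering n -> z p = 0.
  move=> pK; have /(congr1 (fun w => component w pK)) := xy.
  by rewrite !component_tuple /z => ->; rewrite subrr.
have zn m p : (value_rank p < m)%N -> deg p = n -> z p = 0.
  elim: m p => // m IHm t; rewrite ltnS => tm tn.
  have [tK|tK] := boolP (t \in covering n); first exact: zK.
  have [|s [sK ts st]] := @tailP n t; first by rewrite inE tK inE tn /=.
  (* The values of [z] on the facets of [s] all come from [z s], so the tuple they form has class
     zero in $F_{n+1}(s)$. By induction it is supported at [t], which forces [z t = 0]. *)
  have -> : z t = component (under_map deg (Fn deg n) n s (z s)) ts.
    by rewrite component_tuple zarr.
  apply: single_class_eq0 (deg_covering sK) _ _.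
    move=> p ps pt; rewrite component_tuple zarr; apply: IHm.
      exact: leq_trans (value_rank_lt (facet_lt tn st ps pt)) tm.
    by apply/eqP; rewrite -eqSS -card_vertices (card_under ps).
  exact: (coker_pi_im (under_map deg (Fn deg n) n s)).
apply/val_inj/ffunP => q; apply/eqP; rewrite -subr_eq0; apply/eqP.
apply: (under_map_eq0 (x := z q)); apply: component_eq => p pu.
rewrite component0 component_tuple zarr; apply: zn (leqnn _) _.
by apply/eqP; rewrite -eqSS -card_vertices (card_under pu).
Qed.

(** * Purity: triangularity of the cover map from tails to heads *)

Section Purity.
Variable n : nat.
Local Notation tails := (Ob deg n :\: covering n).
Local Notation Fn' := (Fn deg n.+1).
Local Notation Phi := (cover_map (covering n) (covering_sub n.+1)).

(** The representative whose class is the component at [s] of the cover map. *)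
Definition spread (s : Q) (a : prod_over (Fn deg n) tails) :
    prod_over (Fn deg n) (under_deg deg s n) :=
  restr (Fn deg n) (under_Ob deg s n) (extend0 (Fn deg n) tails (Ob deg n) a).

Lemma component_cover_map a (s : Q) (sK : s \in covering n.+1) :
  component (Phi a) sK = next_class deg (Fn deg n) n s (spread s a).
Proof. by rewrite component_tuple component_tuple. Qed.

Lemma component_spread (s : Q) a p (ps : p \in under_deg deg s n) (pT : p \in tails) :
  component (spread s a) ps = component a pT.
Proof. by rewrite component_tuple component_extend0. Qed.

Lemma component_spread_out (s : Q) a p (ps : p \in under_deg deg s n) :
  p \notin tails -> component (spread s a) ps = 0.
Proof. by move=> pT; rewrite component_tuple component_extend0_out. Qed.

Lemma deg_tail (t : Q) : t \in tails -> deg t = n.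
Proof. by rewrite in_tails => /andP[/eqP]. Qed.

(** This is triangularity: a facet of [s] other than [t] either is a tail of smaller rank, where [a]
    vanishes, or is not a tail and receives zero from the extension. *)
Lemma spread_supported (s t : Q) a : s \in up t -> t \in tails ->
  (forall p (pT : p \in tails), (value_rank p < value_rank t)%N -> component a pT = 0) ->
  supported_at t (spread s a).
Proof.
move=> st tT a0 p ps pt; have [pT|pT] := boolP (p \in tails).
  rewrite (component_spread _ _ pT); apply/a0/value_rank_lt.
  exact: facet_lt (deg_tail tT) st ps pt.
exact: component_spread_out.
Qed.

Definition head (s : Q) := exists2 t : Q, t \in tails & s \in up t.

(** Induction on the rank of the tail, using injectivity of the diagonal entries. Testing only the
    head components is what independence in the cokernel requires. *)
Lemma cover_map_injective a :
  (forall s (sK : s \in covering n.+1), head s -> component (Phi a) sK = 0) -> a = 0.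
Proof.
move=> a0; suff H m t (tT : t \in tails) : (value_rank t < m)%N -> component a tT = 0.
  by apply: component_eq => t tT; rewrite component0; apply: H (leqnn _).
elim: m t tT => // m IHm t tT; rewrite ltnS => tm.
have [s [sK ts st]] := tailP tT.
rewrite -(component_spread a ts); apply: single_class_eq0 (deg_covering sK) _ _.
  by apply: spread_supported => // p pT pt; apply: IHm (leq_trans pt tm).
by rewrite -(component_cover_map a sK); apply: a0; exists t.
Qed.

(** Forward substitution: the head equations are solved for tails of increasing rank. *)
Lemma cover_map_surjective (b : prod_over Fn' (covering n.+1)) :
  exists a, forall s (sK : s \in covering n.+1), head s ->
    component (Phi a) sK = component b sK.
Proof.
suff H m : exists a, forall s (sK : s \in covering n.+1) (t : Q), t \in tails ->
    s \in up t -> (value_rank t < m)%N -> component (Phi a) sK = component b sK.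
  have [a aP] := H #|{: simplex P}|.+1; exists a => s sK [t tT st].
  by apply: (aP s sK t) => //; rewrite ltnS max_card.
elim: m => [|m [a aP]]; first by exists 0.
(* The correction [e] lives on tails of rank exactly [m] and absorbs the residue [b - Phi a] at
   their heads. Its value at [t] is specified through every tuple supported at [t], so as to apply
   to [spread s e]. *)
have [e eP] : exists e : prod_over (Fn deg n) tails, forall t (tT : t \in tails),
    if value_rank t == m then
      forall s (sK : s \in covering n.+1) (ts : t \in under_deg deg s n), s \in up t ->
        forall y, supported_at t y -> component y ts = component e tT ->
        next_class deg (Fn deg n) n s y = component (b - Phi a) sK
    else component e tT = 0.
  apply: (tuple_choice (R := fun t tT x => if value_rank t == m then
      forall s (sK : s \in covering n.+1) (ts : t \in under_deg deg s n), s \in up t ->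
        forall y, supported_at t y -> component y ts = x ->
        next_class deg (Fn deg n) n s y = component (b - Phi a) sK
    else x = 0)) => t tT.
  case: eqP => _; last by exists 0.
  have [s [sK ts st]] := tailP tT.
  have [y sy yc] := single_class_surj (component (b - Phi a) sK) (deg_covering sK) ts.
  (* A tail has only one head, so the requirement over all [s'] concerns [s] alone. *)
  exists (component y ts) => s' s'K ts' s't; have e := up_unique s't st.
  subst s'; rewrite (bool_irrelevance s'K sK) (bool_irrelevance ts' ts) => z sz zy.
  by rewrite (supported_at_eq sz sy zy).
exists (a + e) => s sK t tT st; rewrite ltnS => tm.
have e0 p (pT : p \in tails) : (value_rank p < value_rank t)%N -> component e pT = 0.
  by move=> pt; have := eP p pT; rewrite ltn_eqF // (leq_trans pt tm).
have se := spread_supported st tT e0.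
have := st; rewrite (mem_up _ (deg_tail tT)) => /and3P[ts _ _].
rewrite raddfD componentD; have := eP t tT; case: eqP => [_|/eqP ne] et.
  have -> : component (Phi e) sK = component (b - Phi a) sK.
    apply: etrans (component_cover_map e sK) _.
    exact: (et s sK ts st _ se (component_spread e ts tT)).
  by rewrite componentB addrC subrK.
(* For a tail of smaller rank the equation already holds, and [e] does not disturb it. *)
have etm : (value_rank t < m)%N by rewrite ltn_neqAle ne.
have -> : component (Phi e) sK = 0.
  apply: etrans (component_cover_map e sK) _.
  have -> : spread s e = 0; last exact: raddf0.
  apply: component_eq => p ps; rewrite component0.
  have [e1|pt] := eqVneq p t; last exact: se.
  by subst p; rewrite (component_spread _ _ tT).
by rewrite addr0; apply: aP etm.
Qed.

Lemma headP (s : Q) : deg s = n.+1 -> down s != set0 -> head s.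
Proof.
move=> sn /set0Pn[t]; rewrite mem_down => st; exists (t : Q) => //.
have tn : deg t = n.
  by apply/eqP; have := st; rewrite inE -[simplex_dim s]/(deg s) sn => /and3P[_ /eqP[->]].
by rewrite in_tails tn eqxx; apply/set0Pn; exists s.
Qed.

(** The classes of generators at critical simplices form a basis of the cokernel. They span, since
    subtracting some [Phi a] clears all head components; they are independent, since a combination
    of the form [Phi a] has zero head components, whence [a = 0]. *)
Lemma cover_map_pure : pure Phi.
Proof.
(* Members of [covering n.+1] have no upper exception, so [I] indexes the critical simplices of
   dimension [n+1]. *)
pose I := {s : Q | (s \in covering n.+1) && (down s == set0)}.
have iK (i : I) : val i \in covering n.+1 by case/andP: (valP i).
have not_head (i : I) : ~ head (val i).
  case=> t _; rewrite -mem_down; case/andP: (valP i) => _ /eqP ->.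
  by rewrite inE.
have /choice[y yP] : forall i : I, exists y : prod_over Fn' (covering n.+1),
    [/\ supported_at (val i) y,
        forall x, exists k : int, x = component y (iK i) *~ k &
        forall k : int, component y (iK i) *~ k = 0 -> k = 0].
  move=> i; have [u [ugen ufree]] := generator_exists (deg_covering (iK i)).
  by have [y sy yu] := single_exists (iK i) u; exists y; rewrite yu.
have sy k i : supported_at (val i) (y i *~ k i).
  by apply: supported_atMz; case: (yP i).
have sum_at k i : component (\sum_j y j *~ k j) (iK i) = component (y i) (iK i) *~ k i.
  apply: etrans (component_sum_at (sy k) (iK i) val_inj) _.
  exact: componentMz.
have sum_head k s (sK : s \in covering n.+1) : head s -> component (\sum_j y j *~ k j) sK = 0.
  move=> sh; apply: (component_sum_out (sy k)) => i.
  by apply/eqP => si; case: (not_head i); rewrite -si.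
have pi_sum k : \sum_j coker_pi Phi (y j) *~ k j = coker_pi Phi (\sum_j y j *~ k j).
  by rewrite raddf_sum; apply: eq_bigr => j _; rewrite raddfMz.
apply: (@free_abelian_basis _ I (fun i => coker_pi Phi (y i))) => [x|k].
  elim/coker_ind: x => b; have [a aP] := cover_map_surjective b.
  have /choice[k kP] : forall i : I, exists k : int,
      component (b - Phi a) (iK i) = component (y i) (iK i) *~ k.
    by move=> i; have [_ ygen _] := yP i.
  exists k; rewrite pi_sum; suff -> : \sum_j y j *~ k j = b - Phi a.
    by rewrite raddfB /= coker_pi_im subr0.
  apply: component_eq => s sK; have [s0|s0] := boolP (down s == set0).
    have sI : (s \in covering n.+1) && (down s == set0) by rewrite sK.
    pose i : I := exist _ s sI.
    by rewrite (bool_irrelevance sK (iK i)); apply: etrans (sum_at k i) (esym (kP i)).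
  have sh := headP (deg_covering sK) s0.
  apply: etrans (sum_head k s sK sh) _.
  apply/esym; apply: etrans (componentB b (Phi a) sK) _.
  apply/eqP; rewrite subr_eq0; apply/eqP/esym.
  exact: aP.
rewrite pi_sum => /eqP/coker_piP[a aE].
have a0 : a = 0 by apply: cover_map_injective => s sK sh; rewrite aE; apply: sum_head.
move=> i; have [_ _ yfree] := yP i; apply: yfree.
apply: etrans (esym (sum_at k i)) _.
by rewrite -aE a0 raddf0; apply: component0.
Qed.

End Purity.

(** * Betti numbers and the count of critical simplices *)

Definition morse_covering : global_covering_family deg :=
  GlobalCoveringFamily lim_restr_injective cover_map_pure.

(** In its own dimension a simplex has $R = 1$, so the sums in the Betti numbers are
    cardinalities. *)
Lemma sum_Rn n (A : {set Q}) : A \subset Ob deg n -> \sum_(p in A) Rn deg n p = #|A|%:Z.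
Proof.
move=> /subsetP An; rewrite (eq_bigr (fun=> 1)) ?sumr_const ?natz //.
by move=> p /An; rewrite inE => /eqP pn; rewrite RnE pn ?binn.
Qed.

(** Double counting of the pairs [(p, q)] with [q \in up p] and [p] of dimension [n]: by the Morse
    condition each simplex occurs at most once on either side. *)
Lemma card_tails_heads n :
  #|Ob deg n :\: covering n| = #|[set q : Q | (deg q == n.+1) && (down q != set0)]|.
Proof.
have card01 (A : {set simplex P}) : (#|A| <= 1)%N -> (A != set0 : nat) = #|A|.
  by rewrite -card_gt0; case: #|A| => [|[]].
transitivity (\sum_(p : Q | deg p == n) \sum_(q : Q) (q \in up p))%N.
  rewrite -sum1_card [LHS]big_mkcond [RHS]big_mkcond /=; apply: eq_bigr => p _.
  rewrite in_tails; case: eqP => //= _.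
  by rewrite -big_mkcond /= sum1_card -(card01 _ (f_morse p).1); case: (up p != set0).
rewrite exchange_big -sum1_card [RHS]big_mkcond /=; apply: eq_bigr => q _.
rewrite inE; case: eqP => [qn|/eqP qn] /=.
  transitivity #|down q|; last by rewrite -(card01 _ (f_morse q).2); case: (down q != set0).
  rewrite -sum1_card big_mkcond [RHS]big_mkcond /=; apply: eq_bigr => p _.
  rewrite mem_down; case: ifP => [_|pn]; first by case: (q \in up p).
  case: ifP => // qp; move: qp; rewrite (mem_up _ (erefl (deg p))) qn eqSS.
  by case/and3P => _ /eqP np; rewrite np eqxx in pn.
rewrite big1 // => p /eqP pn; case: (boolP (q \in up p)) => //.
by rewrite (mem_up _ pn) (negPf qn) andbF.
Qed.

(** The covering set is split by the presence of a lower exception. Without one the simplex is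
    critical; with one, Forman's lemma already excludes upper exceptions. *)
Lemma card_covering n : #|covering n| =
  (#|[set p : simplex P | critical f p & simplex_dim p == n]| +
   #|[set q : Q | (deg q == n) && (down q != set0)]|)%N.
Proof.
rewrite -(cardsID [set q : simplex P | down q == set0] (covering n)); congr (_ + _)%N.
  by apply: eq_card => p; rewrite !inE /critical !cards_eq0 -andbA andbC.
apply: eq_card => q; rewrite !inE andbCA; congr (_ && _).
case: (down q =P set0) => [//|/eqP/set0Pn[p]]; rewrite mem_down => qp.
by apply/negPn/negP => /set0Pn[r]; apply: up_down_disjoint qp.
Qed.

(** In positive degree, the difference of the first two sums is minus the number of tails, which
    cancels the heads counted in the third. *)
Lemma betti_morse_covering n : betti morse_covering n =
  #|[set p : simplex P | critical f p & simplex_dim p == n]|%:Z.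
Proof.
case: n => [|n].
  apply: etrans (sum_Rn (covering_sub 0)) _; rewrite card_covering.
  (* A vertex has no facets, so there are no heads in dimension 0. *)
  rewrite [X in (_ + X)%N](_ : _ = 0%N) ?addn0 //.
  apply/eqP; rewrite cards_eq0; apply/eqP/setP => q; rewrite !inE.
  apply/negP => /andP[q0 /set0Pn[p]]; rewrite inE.
  by rewrite -[simplex_dim q]/(deg q) (eqP q0) andbF.
rewrite /betti -[gcf_set _]/covering !sum_Rn ?covering_sub // [in X in _ + X]card_covering PoszD.
rewrite -card_tails_heads.
rewrite -(cardsID (covering n) (Ob deg n)) (setIidPr (covering_sub n)) PoszD.
by rewrite opprD [X in X + _]addrA subrr add0r addrCA addNr addr0.
Qed.

End MorseCovering.

Theorem proposition7p2 (R : realType) (V : finType) (P : simplicial_complex V)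
    (f : simplex P -> R) (f_morse : morse f) :
  exists K : global_covering_family (@simplex_op_deg V P),
    forall n : nat,
      betti K n = #|[set p : simplex P | critical f p & simplex_dim p == n]|%:Z.
Proof. by exists (morse_covering f_morse) => n; apply: betti_morse_covering. Qed.
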